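(* Let $\nu,\mu$ be computable probability measures on Cantor space $2^{\mathbb{N}}$ with full support. If $\nu\ll_{\mathsf{MLR}} \mu$, then $\nu$ is absolutely continuous with respect to $\mu$, i.e. $\nu\ll \mu$.
   Context: A probability measure $\nu$ on Cantor space is computable if the reals $\nu([\sigma])$ are computable uniformly in $\sigma\in2^{<\mathbb{N}}$, where $[\sigma]$ is the set of $\omega\in 2^{\mathbb{N}}$ extending $\sigma$; it has full support if $\nu([\sigma])>0$ for all $\sigma$. A c.e. open set is one of the form $\bigcup_n[\sigma_n]$ for a computable sequence $\sigma_n$ of binary strings. $\mathsf{MLR}^{\nu}$ (Martin-Löf $\nu$-random points) is the set of $\omega$ such that $\omega\notin\bigcap_n U_n$ for every computable sequence $U_n$ of c.e. opens with $\nu(U_n)\le 2^{-n}$ for all $n\ge 0$. $\nu\ll_{\mathsf{MLR}}\mu$ means $\mathsf{MLR}^{\nu}\subseteq\mathsf{MLR}^{\mu}$. *)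

(* Defs.v *)
From HB Require Import structures.
From mathcomp Require Import all_boot all_order all_algebra.
From mathcomp Require Import all_classical all_reals all_analysis.
Set Implicit Arguments.
Unset Strict Implicit.
Unset Printing Implicit Defensive.
Import Order.TTheory GRing.Theory Num.Theory.
Local Open Scope classical_set_scope.
Local Open Scope ring_scope.

(* The (total) recursive functions: the least class of functions on nat
   containing the zero functions, the successor and the projections, and closed
   under composition, primitive recursion, and minimization of regular
   functions, i.e. of those f such that f (_, v) has a zero for every v. In the
   last two clauses h is given by its defining equations; the recursion
   (resp. minimization) variable is the first argument. *)
Inductive recursive : forall n : nat, (n.-tuple nat -> nat) -> Prop :=
| recursive_zero n : recursive (fun _ : n.-tuple nat => 0%N)
| recursive_succ : recursive (fun v : 1.-tuple nat => (tnth v ord0).+1)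
| recursive_proj n (i : 'I_n) : recursive (fun v : n.-tuple nat => tnth v i)
| recursive_comp m n (f : m.-tuple nat -> nat)
    (g : 'I_m -> n.-tuple nat -> nat) :
    recursive f -> (forall i, recursive (g i)) ->
    recursive (fun v : n.-tuple nat => f [tuple g i v | i < m])
| recursive_primrec n (f : n.-tuple nat -> nat) (g : n.+2.-tuple nat -> nat)
    (h : n.+1.-tuple nat -> nat) :
    recursive f -> recursive g ->
    (forall v : n.-tuple nat, h [tuple of 0%N :: v] = f v) ->
    (forall (y : nat) (v : n.-tuple nat), h [tuple of y.+1 :: v] =
       g [tuple of y :: h [tuple of y :: v] :: v]) ->
    recursive h
| recursive_min n (f : n.+1.-tuple nat -> nat) (h : n.-tuple nat -> nat) :
    recursive f ->
    (forall v : n.-tuple nat, f [tuple of h v :: v] = 0%N) ->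
    (forall (v : n.-tuple nat) (y : nat), (y < h v)%N ->
       f [tuple of y :: v] <> 0%N) ->
    recursive h.

Definition computable2 (f : nat -> nat -> nat) : Prop :=
  recursive (fun v : 2.-tuple nat => f (tnth v ord0) (tnth v ord_max)).

(* Bijection between binary strings and nat (bijective base-2 numeration). *)
Fixpoint string_code (s : seq bool) : nat :=
  if s is b :: s' then ((string_code s').*2 + b.+1)%N else 0%N.

(* The reals x s are computable uniformly in s: from s and k one computes a
   rational (p - q) / (r + 1) within 2^-k of x s. *)
Definition uniformly_computable (R : realType) (x : seq bool -> R) : Prop :=
  exists p q r : nat -> nat -> nat,
    [/\ computable2 p, computable2 q, computable2 r &
      forall (s : seq bool) (k : nat), let c := string_code s in
        `|x s - ((p c k)%:R - (q c k)%:R) / (r c k).+1%:R| <= 2 ^- k].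

(* Cantor space with its Borel sigma-algebra. *)
Notation cantor_borel := (g_sigma_algebraType (@open cantor_space)).

Definition cylinder (s : seq bool) : set cantor_borel :=
  [set w : nat -> bool | mkseq w (size s) = s].

Definition computable_measure (R : realType)
    (nu : probability cantor_borel R) : Prop :=
  uniformly_computable (fun s => fine (nu (cylinder s))).

Definition full_support (R : realType)
    (nu : probability cantor_borel R) : Prop :=
  forall s : seq bool, (0 < nu (cylinder s))%E.

(* U is a computable sequence of c.e. opens: the strings enumerating U n are
   computable uniformly in n. *)
Definition computable_ce_opens (U : nat -> set cantor_borel) : Prop :=
  exists s : nat -> nat -> seq bool,
    computable2 (fun n m => string_code (s n m)) /\
    forall n, U n = \bigcup_m cylinder (s n m).

Definition MLR (R : realType) (nu : probability cantor_borel R) :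
    set cantor_borel :=
  [set w | forall U : nat -> set cantor_borel, computable_ce_opens U ->
     (forall n : nat, (nu (U n) <= (2 ^- n)%:E)%E) -> ~ (\bigcap_n U n) w].

Definition MLR_dominates (R : realType)
    (mu nu : probability cantor_borel R) : Prop :=
  MLR nu `<=` MLR mu.
Notation "nu `<<_MLR mu" := (MLR_dominates mu nu) (at level 51).

(* Main.v *)
Require Import Defs.
From HB Require Import structures.
From mathcomp Require Import all_boot all_order all_algebra.
From mathcomp Require Import all_classical all_reals all_analysis.
From mathcomp Require Import zify ring lra.
Set Implicit Arguments.
Unset Strict Implicit.
Unset Printing Implicit Defensive.
Import Order.TTheory GRing.Theory Num.Theory.
Local Open Scope classical_set_scope.
Local Open Scope ring_scope.

(* Let U_n be the union of the cylinders [s] with nu[s] > 2^n mu[s]. It is c.e.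
   open uniformly in n, and mu(U_n) <= 2^-n because U_n is a disjoint union of
   such cylinders. A cylinder meeting its complement has nu[s] <= 2^n mu[s], so
   that nu restricted to the complement of U_n is at most 2^n mu, first on
   cylinders and then on all Borel sets. Hence if mu(A) = 0 then nu-almost all
   of A lies in every U_n. Since nu-almost every point is nu-random, nu(A) > 0
   would give a nu-random point in the intersection of the U_n, which is
   therefore not mu-random. *)

(** * Recursive functions *)

Definition computable1 (f : nat -> nat) : Prop :=
  recursive (fun v : 1.-tuple nat => f (tnth v ord0)).

Section recursive_combinators.
Variable n : nat.
Implicit Types f g : n.-tuple nat -> nat.

Lemma recursive_comp1 F f : computable1 F -> recursive f ->
  recursive (fun v => F (f v)).
Proof.
move=> rF rf.
have := recursive_comp rF (fun _ : 'I_1 => rf).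
by congr (recursive _); apply/funext => v; rewrite tnth_mktuple.
Qed.

Lemma recursive_comp2 F f g : computable2 F -> recursive f -> recursive g ->
  recursive (fun v => F (f v) (g v)).
Proof.
move=> rF rf rg.
have rfg (i : 'I_2) : recursive (if i == ord0 then f else g) by case: ifP.
have := recursive_comp rF rfg.
by congr (recursive _); apply/funext => v; rewrite !tnth_mktuple.
Qed.

Lemma recursive_succ_comp f : recursive f -> recursive (fun v => (f v).+1).
Proof. exact: recursive_comp1 recursive_succ. Qed.

Lemma recursive_const k : recursive (fun _ : n.-tuple nat => k).
Proof.
by elim: k => [|k /recursive_succ_comp]; first exact: recursive_zero.
Qed.

End recursive_combinators.

Lemma computable2_primrec (F : nat -> nat -> nat) (f : 1.-tuple nat -> nat)
    (g : 3.-tuple nat -> nat) : recursive f -> recursive g ->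
    (forall x, F 0%N x = f [tuple x]) ->
    (forall y x, F y.+1 x = g [tuple y; F y x; x]) ->
  computable2 F.
Proof.
move=> rf rg F0 FS; apply: (recursive_primrec rf rg) => [v|y v].
all: case/tupleP: v => x v; rewrite (tuple0 v) !(tnth_nth 0%N) /=.
  by rewrite F0; congr f; exact: val_inj.
by rewrite FS; congr g; exact: val_inj.
Qed.

Lemma computable2_swap F : computable2 F -> computable2 (fun x y => F y x).
Proof.
move=> rF; apply: (recursive_comp2 rF); exact: recursive_proj.
Qed.

Lemma computable2_addn : computable2 addn.
Proof.
apply: (@computable2_primrec _ (fun v => tnth v ord0)
  (fun v => (tnth v (Ordinal (isT : 1 < 3)%N)).+1)) => //.
- exact: recursive_proj.
- exact/recursive_succ_comp/recursive_proj.
Qed.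

Lemma computable2_muln : computable2 muln.
Proof.
apply: (@computable2_primrec _ (fun=> 0%N)
  (fun v => (tnth v ord_max + tnth v (Ordinal (isT : 1 < 3)%N))%N)) => //.
- exact: recursive_zero.
- by apply: (recursive_comp2 computable2_addn); exact: recursive_proj.
Qed.

Lemma computable1_predn : computable1 predn.
Proof.
apply: (@recursive_primrec 0 (fun=> 0%N) (fun v => tnth v ord0)).
- exact: recursive_zero.
- exact: recursive_proj.
- by [].
- by move=> y v; rewrite !(tnth_nth 0%N).
Qed.

Lemma computable2_subn : computable2 subn.
Proof.
(* Truncated subtraction recurses on the subtrahend, whereas the recursion variable has to come
   first. *)
apply: computable2_swap.
apply: (@computable2_primrec _ (fun v => tnth v ord0)
  (fun v => (tnth v (Ordinal (isT : 1 < 3)%N)).-1)).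
- exact: recursive_proj.
- exact/(recursive_comp1 computable1_predn)/recursive_proj.
- by move=> x; exact: subn0.
- by move=> y x; exact: subnS.
Qed.

Section recursive_arithmetic.
Variable n : nat.
Implicit Types f g : n.-tuple nat -> nat.

Lemma recursive_addn f g : recursive f -> recursive g ->
  recursive (fun v => (f v + g v)%N).
Proof. exact: recursive_comp2 computable2_addn. Qed.

Lemma recursive_muln f g : recursive f -> recursive g ->
  recursive (fun v => (f v * g v)%N).
Proof. exact: recursive_comp2 computable2_muln. Qed.

Lemma recursive_subn f g : recursive f -> recursive g ->
  recursive (fun v => (f v - g v)%N).
Proof. exact: recursive_comp2 computable2_subn. Qed.

End recursive_arithmetic.

Lemma computable1_exp2n : computable1 (expn 2).
Proof.
apply: (@recursive_primrec 0 (fun=> 1%N)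
  (fun v => tnth v ord_max + tnth v ord_max)%N).
- exact: recursive_const.
- by apply: recursive_addn; exact: recursive_proj.
- by [].
- by move=> y v; rewrite !(tnth_nth 0%N) /= expnS mul2n addnn.
Qed.

(** * Unbounded search and enumeration *)

Lemma computable1_min (f : nat -> nat -> nat) : computable2 f ->
  (forall x, exists y, f y x = 0%N) ->
  exists h, computable1 h /\
    forall x, f (h x) x = 0%N /\ forall y, (y < h x)%N -> f y x <> 0%N.
Proof.
move=> rf f0.
have f0b x : exists y, f y x == 0%N by have [y fy] := f0 x; exists y; exact/eqP.
pose h x := ex_minn (f0b x).
have hP x : f (h x) x = 0%N /\ forall y, (y < h x)%N -> f y x <> 0%N.
  rewrite /h; case: ex_minnP => m /eqP fm mmin; split => // y ym fy.
  by have := mmin y; rewrite fy eqxx leqNgt ym => /(_ isT).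
exists h; split=> //.
apply: (recursive_min rf) => [v|v y].
all: case/tupleP: v => x v; rewrite (tuple0 v) !(tnth_nth 0%N) /=.
  by have [] := hP x.
by have [_] := hP x; apply.
Qed.

(** Since each [c] recurs at arbitrarily late stages [m], the stage can double as a precision. Here
    [h m] is the integer square root of [m] and [e m = m - (h m)^2], so that [c] appears at
    [(c + k)^2 + c] for every [k]. *)
Lemma computable1_frequent_enum : exists e, computable1 e /\
  forall c k, exists2 m, (k <= m)%N & e m = c.
Proof.
have [||h [rh hP]] :=
    @computable1_min (fun y m => (m.+1 - y.+1 * y.+1)%N).
- apply: recursive_subn; first exact/recursive_succ_comp/recursive_proj.
  by apply: recursive_muln; exact/recursive_succ_comp/recursive_proj.
- by move=> m; exists m; nia.
exists (fun m => (m - h m * h m)%N); split.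
  apply: recursive_subn; first exact: recursive_proj.
  by apply: recursive_muln; exact: rh.
move=> c k; exists ((c + k) * (c + k) + c)%N; first by nia.
have [hm hmin] := hP ((c + k) * (c + k) + c)%N.
suff -> : h ((c + k) * (c + k) + c)%N = (c + k)%N by rewrite addnC addnK.
have [hlt|hgt|//] := ltngtP (h ((c + k) * (c + k) + c)%N) (c + k)%N.
  by nia.
by have := hmin _ hgt; nia.
Qed.

(** * Numbering of binary strings *)

Lemma string_code_inj : injective string_code.
Proof.
elim=> [|b s IH] [|b' s'] //=; rewrite ?addnS //.
(* Without the successor, a code is twice the code of the tail plus the first bit: parity and half
   recover both. *)
move=> [] /(congr1 (fun k => (odd k, k./2))).
rewrite !oddD !odd_double !halfD !odd_double !doubleK.
by case: b; case: b' => //=; rewrite ?addn0 ?add0n => -[] // /IH ->.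
Qed.

Lemma string_code_surj c : exists s, string_code s = c.
Proof.
have [k] := ubnP c; elim: k c => // k IH [|c] ck; first by exists [::].
have [|s sE] := IH c./2; first by lia.
by exists (odd c :: s); rewrite /= sE; lia.
Qed.

(** An inverse by choice is enough, because computability is only ever stated for codes. *)
Definition string_decode (c : nat) : seq bool :=
  xget [::] [set s | string_code s = c].

Lemma string_decodeK : cancel string_decode string_code.
Proof.
by move=> c; rewrite /string_decode; case: xgetP => [s _ //|/(_ _) sN];
  have [s /sN] := string_code_surj c.
Qed.

Lemma string_codeK : cancel string_code string_decode.
Proof. exact: inj_can_sym string_decodeK string_code_inj. Qed.

(** * C.e. opens from semidecidable inequalities *)

(* A total enumeration cannot leave gaps, so indices failing the test [A n]
   are sent to the cylinder of the first index passing it. *)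
Lemma computable_ce_opens_semidecidable (A : nat -> nat -> nat) e :
  computable2 A -> computable1 e -> (forall n, exists m, A n m <> 0%N) ->
  computable_ce_opens (fun n =>
    \bigcup_(m in [set m | A n m <> 0%N]) cylinder (string_decode (e m))).
Proof.
move=> rA re Aex.
have [||h [rh hP]] := @computable1_min (fun m n => (1 - A n m)%N).
- apply: recursive_subn; first exact: recursive_const.
  exact: computable2_swap.
- by move=> n; have [m Am] := Aex n; exists m; lia.
(* [b n m] is 1 if the test passes and 0 otherwise, which turns the case distinction into
   arithmetic. *)
pose b n m := (1 - (1 - A n m))%N.
exists (fun n m => string_decode (b n m * e m + (1 - b n m) * e (h n))%N).
split.
  under [X in computable2 X]eq_fun do
    under eq_fun do rewrite string_decodeK.
  have rb : computable2 b.
    by do 2?[apply: recursive_subn; first exact: recursive_const].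
  apply: recursive_addn; apply: recursive_muln => //.
  - exact/(recursive_comp1 re)/recursive_proj.
  - by apply: recursive_subn => //; exact: recursive_const.
  - exact/(recursive_comp1 re)/(recursive_comp1 rh)/recursive_proj.
move=> n; apply/seteqP; split=> [w [m /= Am wm]|w [m _]].
  exists m => //; have -> : b n m = 1%N by rewrite /b; lia.
  by rewrite mul1n mul0n addn0.
have [Am|Am] := eqVneq (A n m) 0%N.
  have -> : b n m = 0%N by rewrite /b Am.
  rewrite mul0n add0n subn0 mul1n => wh; exists (h n) => //=.
  by have [/[swap] _] := hP n; lia.
have -> : b n m = 1%N by rewrite /b; lia.
by rewrite mul1n mul0n addn0 => wm; exists m => //; exact/eqP.
Qed.

(* The inequality [2^n (b + 2^-k) < a - 2^-k], with [a = (p - q)/(r + 1)] and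
   [b = (p' - q')/(r' + 1)], after clearing denominators. *)
Definition ratio_test (n k p q r p' q' r' : nat) : nat :=
  (p * r'.+1 * 2 ^ k + 2 ^ n * q' * r.+1 * 2 ^ k -
   (q * r'.+1 * 2 ^ k + r.+1 * r'.+1 + 2 ^ n * p' * r.+1 * 2 ^ k +
    2 ^ n * r.+1 * r'.+1))%N.

Lemma ratio_testP (R : realType) n k p q r p' q' r' :
  ratio_test n k p q r p' q' r' <> 0%N <->
  2 ^+ n * ((p'%:R - q'%:R) / r'.+1%:R + 2 ^- k)
    < (p%:R - q%:R) / r.+1%:R - 2 ^- k :> R.
Proof.
set a := (p%:R - q%:R) / r.+1%:R; set b := (p'%:R - q'%:R) / r'.+1%:R.
have -> : (ratio_test n k p q r p' q' r' <> 0%N) = 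
   (q * r'.+1 * 2 ^ k + r.+1 * r'.+1 + 2 ^ n * p' * r.+1 * 2 ^ k +
    2 ^ n * r.+1 * r'.+1 < p * r'.+1 * 2 ^ k + 2 ^ n * q' * r.+1 * 2 ^ k)%N.
  by rewrite -subn_gt0 lt0n; apply/propext; split => /eqP.
rewrite -(ltr_nat R) !(natrD, natrM, natrX) -subr_gt0 -[_ < a - _]subr_gt0.
have r0 : r.+1%:R != 0 :> R by rewrite pnatr_eq0.
have r'0 : r'.+1%:R != 0 :> R by rewrite pnatr_eq0.
have k0 : 2 ^+ k != 0 :> R by rewrite expf_neq0 // pnatr_eq0.
rewrite [X in (0 < X) <-> _](_ : _ = r.+1%:R * r'.+1%:R * 2 ^+ k *
   (a - 2 ^- k - 2 ^+ n * (b + 2 ^- k))).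
  by rewrite pmulr_rgt0 // !mulr_gt0 // ?exprn_gt0 // ltr0n.
rewrite {}/a {}/b; move: r0 r'0 k0; move: r.+1%:R r'.+1%:R (2 ^+ k)
  => N M K N0 M0 K0. by field; rewrite K0 M0.
Qed.

(** At stage [m] the string coded by [e m] is tested with both reals approximated within [2^-m]. A
    passed test proves the inequality, and a true inequality passes at every late enough stage
    devoted to its string. The last hypothesis provides the default index for failed tests. *)
Lemma computable_ce_opens_ratio (R : realType) (x y : seq bool -> R) :
  uniformly_computable x -> uniformly_computable y ->
  (forall n, exists s, 2 ^+ n * y s < x s) ->
  computable_ce_opens
    (fun n => \bigcup_(s in [set s | 2 ^+ n * y s < x s]) cylinder s).
Proof.
move=> [p [q [r [rp rq rr]]]] xE [p' [q' [r' [rp' rq' rr']]]] yE xy.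
have [e [re eP]] := computable1_frequent_enum.
pose A n m := ratio_test n m (p (e m) m) (q (e m) m) (r (e m) m)
  (p' (e m) m) (q' (e m) m) (r' (e m) m).
have rA : computable2 A.
  have rproj0 : recursive (fun v : 2.-tuple nat => tnth v ord0) by
    exact: recursive_proj.
  have rproj1 : recursive (fun v : 2.-tuple nat => tnth v ord_max) by
    exact: recursive_proj.
  have rpow0 := recursive_comp1 computable1_exp2n rproj0.
  have rpow1 := recursive_comp1 computable1_exp2n rproj1.
  have rapprox f : computable2 f ->
      recursive (fun v : 2.-tuple nat =>
        f (e (tnth v ord_max)) (tnth v ord_max)).
    move=> rf; apply: (recursive_comp2 rf _ rproj1).
    exact: recursive_comp1 re rproj1.
  by rewrite /A /ratio_test; repeat first
    [ assumption | exact: rapprox | apply: recursive_subn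
    | apply: recursive_addn | apply: recursive_muln
    | apply: recursive_succ_comp ].
have w0 n : 0 <= 2 ^+ n :> R by rewrite exprn_ge0.
have AP n m : A n m <> 0%N ->
    2 ^+ n * y (string_decode (e m)) < x (string_decode (e m)).
  move=> /(ratio_testP R).
  have := xE (string_decode (e m)) m; have := yE (string_decode (e m)) m.
  rewrite /= string_decodeK !ler_distl.
  move: ((_ - _) / _) ((_ - _) / _) => a b /andP[_ yb] /andP[ax _] ab.
  have ayb : 2 ^+ n * y (string_decode (e m)) <= 2 ^+ n * (b + 2 ^- m).
    by rewrite (ler_wpM2l (w0 n)).
  by apply: (le_lt_trans ayb); apply: (lt_le_trans ab); lra.
have APr n s : 2 ^+ n * y s < x s ->
    exists2 m, A n m <> 0%N & string_decode (e m) = s.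
  rewrite -subr_gt0 => d0.
  (* The approximations and the margins of the test cost at most [2 (1 + 2^n) 2^-m] in total, which
     is below the gap [x s - 2^n y s] once [m > k], as [m < 2^m]. *)
  pose k := Num.truncn (2 * (1 + 2 ^+ n) / (x s - 2 ^+ n * y s)).
  have [m km em] := eP (string_code s) k.+1.
  exists m; last by rewrite em string_codeK.
  have two_m : 2 * (1 + 2 ^+ n) * 2 ^- m < x s - 2 ^+ n * y s.
    rewrite ltr_pdivrMr; last by rewrite exprn_gt0.
    rewrite [ltRHS]mulrC -ltr_pdivrMr //.
    apply: (lt_le_trans (truncnS_gt _)).
    apply: (@le_trans _ _ m%:R); first by rewrite ler_nat.
    by rewrite -natrX ler_nat ltnW // ltn_expl.
  apply/(ratio_testP R).
  have := xE s m; have := yE s m; rewrite /= -em !ler_distl.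
  move: ((_ - _) / _) ((_ - _) / _) => a b /andP[by_ _] /andP[_ xa].
  have byn : 2 ^+ n * (b - 2 ^- m) <= 2 ^+ n * y s.
    by rewrite (ler_wpM2l (w0 n)).
  move: two_m byn xa; set z := 2 ^- m; set w := 2 ^+ n => two_m byn xa.
  by nra.
have Aex n : exists m, A n m <> 0%N.
  by have [s /APr[m Am _]] := xy n; exists m.
have := computable_ce_opens_semidecidable rA re Aex.
congr (computable_ce_opens _); apply/funext => n; apply/seteqP; split.
- by move=> w [m /AP mxy wm]; exists (string_decode (e m)).
- by move=> w [s /APr[m Am <-] ws]; exists m.
Qed.

(** * Countability of the recursive functions *)

(* Trees serve as programs mapping lists to lists, so that the vector of inner
   functions of a composition is itself a program. A tree is a leaf [i] for the
   [i]-th projection, and otherwise its root label gives the operation. *)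
Fixpoint run (t : GenTree.tree nat) (v : seq nat) : seq nat :=
  match t with
  | GenTree.Leaf i => [:: nth 0%N v i]
  | GenTree.Node 0 _ => [:: (head 0%N v).+1]
  | GenTree.Node 1 [:: f; g] => head 0%N (run f v) :: run g v
  | GenTree.Node 2 [:: f; g] => run f (run g v)
  | GenTree.Node 3 [:: f; g] =>
      (fix loop (y : nat) : seq nat :=
        if y is y'.+1 then run g [:: y', head 0%N (loop y') & behead v]
        else run f (behead v)) (head 0%N v)
  | GenTree.Node 4 [:: f] =>
      [:: xget 0%N [set y | head 0%N (run f (y :: v)) = 0%N /\
            forall z, (z < y)%N -> head 0%N (run f (z :: v)) <> 0%N]]
  | _ => [::]
  end.

(** Induction on the derivation, each constructor having its clause in [run]. The interpreter may be
    noncomputable, and indeed minimizes by choice: only the countability of programs matters. *)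
Lemma recursive_run n (f : n.-tuple nat -> nat) : recursive f ->
  exists t, forall v : n.-tuple nat, head 0%N (run t v) = f v.
Proof.
elim=> {n f}.
- by move=> n; exists (GenTree.Leaf n) => v /=; rewrite nth_default ?size_tuple.
- by exists (GenTree.Node 0 [::]) => v /=; rewrite (tnth_nth 0%N) nth0.
- move=> n i; exists (GenTree.Leaf (i : nat)) => v /=.
  by rewrite (tnth_nth 0%N).
- move=> m n f g _ [tf tfE] _ tg.
  have {tg}[tg tgE] := choice tg.
  have [t tE] : exists t, forall v : n.-tuple nat,
      run t v = [seq g i v | i <- enum 'I_m].
    elim: (enum 'I_m) => [|i s [t tE]].
      (* The label 5 falls into the default case of [run], whose output is the empty list. *)
      by exists (GenTree.Node 5 [::]).
    by exists (GenTree.Node 1 [:: tg i; t]) => v /=; rewrite tE tgE.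
  exists (GenTree.Node 2 [:: tf; t]) => v /=; rewrite tE -tfE.
  by rewrite -val_ord_tuple.
- move=> n f g h _ [tf tfE] _ [tg tgE] h0 hS.
  exists (GenTree.Node 3 [:: tf; tg]) => v /=.
  case/tupleP: v => y v /=; elim: y => [|y IH]; first by rewrite h0 -tfE.
  by rewrite IH hS -tgE.
- move=> n f h _ [tf tfE] fh hmin.
  exists (GenTree.Node 4 [:: tf]) => v /=.
  have hP : head 0%N (run tf (h v :: v)) = 0%N /\
      forall z, (z < h v)%N -> head 0%N (run tf (z :: v)) <> 0%N.
    split=> [|z zh]; first by have := fh v; rewrite -tfE.
    by have := hmin v z zh; rewrite -tfE.
  case: xgetP => [y _ [y0 ymin]|/(_ (h v))//].
  have [yh|hy|//] := ltngtP y (h v); first by case: hP => _ /(_ _ yh).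
  by case: hP => h0 _; have := ymin _ hy.
Qed.

(** Makes the family of Martin-Löf tests countable, so that the null sets they define have a null
    union. *)
Lemma computable2_enum : exists E : nat -> nat -> nat -> nat,
  forall f, computable2 f -> exists k, E k = f.
Proof.
exists (fun k x y => if choice.unpickle k is Some t then
  head 0%N (run t [:: x; y]) else 0%N).
move=> f /recursive_run[t tE]; exists (choice.pickle t).
apply/funext => x; apply/funext => y; rewrite choice.pickleK.
by have := tE [tuple x; y]; rewrite !(tnth_nth 0%N).
Qed.

(** * Measures on Cantor space *)

Lemma cylinder_mkseq (w : nat -> bool) n : cylinder (mkseq w n) w.
Proof. by rewrite /cylinder /= size_mkseq. Qed.

Lemma take_mkseq (w : nat -> bool) m n : (m <= n)%N ->
  take m (mkseq w n) = mkseq w m.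
Proof. by move=> mn; rewrite -map_take take_iota; move/minn_idPl: mn => ->. Qed.

Lemma cylinder_prefix s t w : cylinder s w -> cylinder t w ->
  (size s <= size t)%N -> prefix s t.
Proof.
rewrite /cylinder /= => sw tw st.
by rewrite prefixE -{1}tw take_mkseq // sw.
Qed.

Lemma cylinder_rcons s b :
  cylinder (rcons s b) = cylinder s `&` [set w : nat -> bool | w (size s) = b].
Proof.
apply/seteqP; split=> w; rewrite /cylinder /= size_rcons mkseqS.
  by move=> /rcons_inj[-> ->].
by move=> [-> ->].
Qed.

Lemma open_cylinder s : open (cylinder s : set cantor_space).
Proof.
elim/last_ind: s => [|s b IH].
  rewrite (_ : cylinder [::] = setT); first exact: openT.
  by apply/seteqP; split.
rewrite cylinder_rcons; apply: openI => //.
rewrite (_ : [set _ | _] = @proj nat (fun=> bool) (size s) @^-1` [set b]) //.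
apply: open_comp; last exact: discrete_open.
by move=> w _; exact: proj_continuous.
Qed.

(** Otherwise each cylinder around [w] contains a point [g n] outside [O]. As [g n] agrees with [w]
    on the first [n] bits, it converges to [w] coordinatewise, hence in the product topology, and
    must enter [O]. *)
Lemma open_cylinder_subset (O : set cantor_space) w : open O -> O w ->
  exists n, cylinder (mkseq w n) `<=` O.
Proof.
move=> oO Ow; apply: contrapT => /forallNP nO.
have /choice[g gP] n : exists v, cylinder (mkseq w n) v /\ ~ O v.
  apply: contrapT => /forallNP vP; apply: (nO n) => v wv.
  by apply: contrapT => Ov; exact: (vP v).
have gw : (g : nat -> cantor_space) @ \oo --> (w : cantor_space).
  apply/cvg_sup => i U [V [[W] oW <-] Ww WU].
  apply: (filterS WU); exists i.+1 => // n /= ni.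
  have [+ _] := gP n; rewrite /cylinder /= size_mkseq.
  move=> /(congr1 (fun s => nth false s i)); rewrite !nth_mkseq // => gwi.
  by move: Ww; rewrite /= -gwi.
have [N _ NO] : \forall n \near \oo, O (g n).
  by apply: gw; exact: open_nbhs_nbhs.
by have [_ nO'] := gP N; apply: nO'; apply: NO => /=.
Qed.

Lemma measurable_cylinder s : measurable (cylinder s).
Proof. by apply: sub_sigma_algebra; exact: open_cylinder. Qed.
#[local] Hint Resolve measurable_cylinder : core.

Lemma measurable_bigcup_cylinder (S : set (seq bool)) :
  measurable (\bigcup_(s in S) cylinder s).
Proof.
by apply: sub_sigma_algebra; apply: bigcup_open => s _; exact: open_cylinder.
Qed.

(* The minimal strings of [S] cover the same set with disjoint cylinders. *)
Lemma le_measure_bigcup_cylinder (R : realType)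
    (m1 m2 : {measure set cantor_borel -> \bar R}) (S : set (seq bool)) :
    (forall s, S s -> (m1 (cylinder s) <= m2 (cylinder s))%E) ->
  (m1 (\bigcup_(s in S) cylinder s) <= m2 (\bigcup_(s in S) cylinder s))%E.
Proof.
move=> m12.
pose M := [set k | S (string_decode k) /\
  forall t, S t -> prefix t (string_decode k) -> t = string_decode k].
have tM : trivIset M (cylinder \o string_decode).
  apply/trivIsetP => i j [Si imin] [Sj jmin] ij.
  apply/eqP; apply: contraNT ij => /set0P[w [/= wi wj]].
  apply/eqP/(can_inj string_decodeK).
  have [st|/ltnW ts] := leqP (size (string_decode i)) (size (string_decode j)).
    by apply: jmin => //; exact: cylinder_prefix wi wj st.
  by apply/esym/imin => //; exact: cylinder_prefix wj wi ts.
have -> : \bigcup_(s in S) cylinder s =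
    \bigcup_(k in M) (cylinder \o string_decode) k.
  apply/seteqP; split=> [w [s Ss sw]|w [k [Sk _]]]; last first.
    by exists (string_decode k).
  have exS : exists n, `[< S (mkseq w n) >].
    by exists (size s); apply/asboolP; rewrite sw.
  (* The shortest prefix of [w] lying in [S] is a minimal string of [S]. *)
  have [n /asboolP Sn nmin] := ex_minnP exS.
  exists (string_code (mkseq w n)); rewrite /M /= string_codeK; last first.
    exact: cylinder_mkseq.
  split=> // t St tn; have tnE : t = mkseq w (size t).
    have := size_prefix tn; rewrite size_mkseq => /(take_mkseq w) <-.
    by apply/esym/eqP; rewrite -prefixE.
  have := nmin (size t); rewrite -tnE => /(_ (introT (asboolP _) St)) nt.
  by rewrite tnE (_ : size t = n) //; apply/eqP; rewrite eqn_leq nt andbT;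
    have := size_prefix tn; rewrite size_mkseq.
rewrite !measure_bigcup //=.
by apply: lee_nneseries => // k; rewrite inE => -[/m12].
Qed.

(** * From clopen sets to Borel sets *)

Definition clopen_ring : set (set cantor_borel) :=
  [set A | exists n (P : set (seq bool)), A = [set w | P (mkseq w n)]].

Lemma clopen_ring_cylinder s : clopen_ring (cylinder s).
Proof. by exists (size s), [set s]. Qed.

Lemma setring_clopen_ring : setring clopen_ring.
Proof.
split=> [|_ _ [n [P ->]] [m [Q ->]]|_ _ [n [P ->]] [m [Q ->]]].
- by exists 0%N, set0.
- exists (maxn n m), [set s | P (take n s) \/ Q (take m s)].
  by apply/seteqP; split=> w /=; rewrite !take_mkseq ?leq_maxl ?leq_maxr.
- exists (maxn n m), [set s | P (take n s) /\ ~ Q (take m s)].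
  by apply/seteqP; split=> w /=; rewrite !take_mkseq ?leq_maxl ?leq_maxr.
Qed.

(** The whole space is clopen, so the generated sigma-ring is closed under complements; an open set
    is the countable union of the cylinders it contains. *)
Lemma measurable_sub_clopen_ring : measurable `<=` <<sr clopen_ring >>.
Proof.
have [r0 rD rU] := smallest_sigma_ring clopen_ring.
apply: smallest_sub.
  split=> // A rA; apply: rD => //.
  by apply: sub_g_sigma_ring; exists 0%N, setT; apply/seteqP; split.
move=> O oO.
have -> : O = \bigcup_k [set w | cylinder (string_decode k) `<=` O /\
    cylinder (string_decode k) w].
  apply/seteqP; split=> [w Ow|w [k _ [kO /kO//]]].
  have [n wnO] := open_cylinder_subset oO Ow.
  exists (string_code (mkseq w n)) => //=; rewrite string_codeK.
  by split => //; exact: cylinder_mkseq.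
apply: rU => k; have [kO|kO] := pselect (cylinder (string_decode k) `<=` O).
  rewrite (_ : [set _ | _] = cylinder (string_decode k)).
    by apply: sub_g_sigma_ring; exact: clopen_ring_cylinder.
  by apply/seteqP; split=> w // [].
by rewrite (_ : [set _ | _] = set0) //; apply/seteqP; split=> w // [].
Qed.

(** An inequality of measures does not pass to differences, which rules out a Dynkin system
    argument. It does pass to monotone limits, finiteness serving for the decreasing ones, and the
    monotone class theorem for rings applies. *)
Lemma le_measure_cylinder (R : realType)
    (m1 m2 : {measure set cantor_borel -> \bar R}) :
    (m1 setT < +oo)%E -> (m2 setT < +oo)%E ->
    (forall s, (m1 (cylinder s) <= m2 (cylinder s))%E) ->
  forall A, measurable A -> (m1 A <= m2 A)%E.
Proof.
move=> m1T m2T m12 A /measurable_sub_clopen_ring.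
pose G := [set A : set cantor_borel | measurable A /\ (m1 A <= m2 A)%E].
suff rG : <<sr clopen_ring >> `<=` G by move=> /rG[].
have fin (m : {measure set cantor_borel -> \bar R}) B :
    (m setT < +oo)%E -> measurable B -> (m B < +oo)%E.
  by move=> mT mB; apply: le_lt_trans mT; rewrite le_measure // inE.
have lim_le (F : (set cantor_borel)^nat) B : (forall i, G (F i)) ->
    m1 \o F @ \oo --> m1 B -> m2 \o F @ \oo --> m2 B -> (m1 B <= m2 B)%E.
  move=> FG c1 c2; rewrite -(cvg_lim _ c1) // -(cvg_lim _ c2) //.
  by apply: lee_lim; [exact: cvgP c1|exact: cvgP c2|
    apply: nearW => i /=; have [] := FG i].
apply: monotone_setring_sub_g_sigma_ring.
- split=> F mono FG; have mF i : measurable (F i) by have [] := FG i.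
    have mU : measurable (\bigcup_i F i) by exact: bigcup_measurable.
    by split=> //; apply: lim_le FG _ _; exact: nondecreasing_cvg_mu.
  have mI : measurable (\bigcap_i F i) by exact: bigcap_measurable.
  by split=> //; apply: lim_le FG _ _; apply: nonincreasing_cvg_mu => //;
    exact: fin.
- exact: setring_clopen_ring.
- move=> _ [n [P ->]].
  have -> : [set w | P (mkseq w n)] =
      \bigcup_(s in [set s | size s = n /\ P s]) cylinder s.
    apply/seteqP; split=> [w Pw|w [s [<- Ps]]].
      by exists (mkseq w n); [rewrite /= size_mkseq|exact: cylinder_mkseq].
    by rewrite /cylinder /= => ->.
  split; first exact: measurable_bigcup_cylinder.
  exact: le_measure_bigcup_cylinder.
Qed.

(** * Randomness *)

(** The points along which the martingale [nu[s] / mu[s]] exceeds [2^n] at some prefix [s], written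
    without division. *)
Definition ratio_open (R : realType) (nu mu : probability cantor_borel R)
    (n : nat) : set cantor_borel :=
  \bigcup_(s in [set s | (2 ^+ n)%:E * mu (cylinder s) < nu (cylinder s)]%E)
    cylinder s.

Lemma measurable_ratio_open (R : realType) (nu mu : probability cantor_borel R)
  n : measurable (ratio_open nu mu n).
Proof. exact: measurable_bigcup_cylinder. Qed.

(** Ville's maximal inequality for this martingale: [2^n mu <= nu] passes from the cylinders to
    their union, where [nu] is at most 1. *)
Lemma ratio_open_le (R : realType) (nu mu : probability cantor_borel R) n :
  (mu (ratio_open nu mu n) <= (2 ^- n)%:E)%E.
Proof.
set U := ratio_open nu mu n.
have mU : measurable U by exact: measurable_ratio_open.
have pow_ge0 : 0 <= 2 ^+ n :> R by rewrite exprn_ge0.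
have : (mscale (NngNum pow_ge0) mu U <= nu U)%E.
  by apply: le_measure_bigcup_cylinder => s /= /ltW.
rewrite /mscale /= => /le_trans/(_ (probability_le1 _ _)).
move=> /(_ mU).
have muU : mu U \is a fin_num by rewrite fin_num_measure.
rewrite -(fineK muU) -EFinM !lee_fin => h.
by rewrite -[leRHS]mul1r ler_pdivlMr ?exprn_gt0 // mulrC.
Qed.

Lemma measure_setD_ratio_open (R : realType)
    (nu mu : probability cantor_borel R) n A : measurable A -> mu A = 0%E ->
  nu (A `\` ratio_open nu mu n) = 0%E.
Proof.
move=> mA muA0; have mC : measurable (~` ratio_open nu mu n).
  by apply: measurableC; exact: measurable_ratio_open.
have pow_ge0 : 0 <= 2 ^+ n :> R by rewrite exprn_ge0.
apply/eqP; rewrite eq_le measure_ge0 andbT setDE.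
have -> : 0%E = mscale (NngNum pow_ge0) mu A by rewrite /mscale /= muA0 mule0.
apply: (@le_measure_cylinder _ (mrestr nu mC)
  (mscale (NngNum pow_ge0) mu)) => //.
- rewrite /= /mrestr setTI; apply: le_lt_trans (ltry 1).
  exact: probability_le1.
- rewrite /= /mscale; apply: lte_mul_pinfty => //.
  by apply: le_lt_trans (ltry 1); exact: probability_le1.
move=> s; rewrite /= /mrestr /mscale /=.
(* Either the cylinder is among those united and misses the complement, or the ratio bound holds for
   it. *)
have [sU|sU] := ltP ((2 ^+ n)%:E * mu (cylinder s))%E (nu (cylinder s)).
  rewrite (_ : _ `&` _ = set0) ?measure0 ?mule_ge0 ?lee_fin //.
  by apply/seteqP; split=> // w [sw]; apply; exists s.
apply: le_trans sU; rewrite le_measure // inE; [|exact: measurable_cylinder].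
by apply: measurableI => //; exact: measurable_cylinder.
Qed.

(** A nonrandom point lies in the intersection of one of countably many tests, and each such
    intersection has measure at most [2^-n] for all [n]. Indices [k] that violate the bounds of a
    test contribute an empty [N k]. *)
Lemma negligible_setC_MLR (R : realType) (nu : probability cantor_borel R) :
  nu.-negligible (~` MLR nu).
Proof.
have [E EP] := computable2_enum.
pose U k n := \bigcup_m cylinder (string_decode (E k n m)).
pose N k := [set w | (forall n, (nu (U k n) <= (2 ^- n)%:E)%E) /\
  (\bigcap_n U k n) w].
apply: (@negligibleS _ _ _ _ (\bigcup_k N k)).
  move=> w; rewrite /MLR /= => /existsNP[V /not_implyP[[s [cs VE]]]].
  move=> /not_implyP[V_le /contrapT Vw].
  have [k Ek] := EP _ cs; exists k => //.
  have UV n : U k n = V n.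
    by rewrite VE /U Ek; apply: eq_bigcupr => m _; rewrite string_codeK.
  by split=> n *; rewrite UV //; exact: Vw.
apply: negligible_bigcup => k.
have mU n : measurable (U k n).
  by apply: bigcup_measurable => m _; exact: measurable_cylinder.
have [U_le|U_gt] := pselect (forall n, (nu (U k n) <= (2 ^- n)%:E)%E);
  last first.
  by rewrite (_ : N k = set0); [exact: negligible_set0|
    apply/seteqP; split=> w // -[]].
apply: (@negligibleS _ _ _ _ (\bigcap_n U k n)) => [w []//|].
have mI : measurable (\bigcap_n U k n) by exact: bigcap_measurable.
apply/negligibleP => //; apply/eqP; rewrite eq_le measure_ge0 andbT.
apply/lee_addgt0Pr => e e0; rewrite add0e.
have [n ne] : exists n, 2 ^- n < e.
  exists (Num.truncn e^-1).+1; rewrite invf_plt ?posrE ?exprn_gt0 //.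
  apply: lt_trans (truncnS_gt _) _.
  by rewrite -natrX ltr_nat ltn_expl.
apply: le_trans (_ : (2 ^- n)%:E <= _)%E; last by rewrite lee_fin ltW.
apply: le_trans (U_le n); rewrite le_measure // ?inE //.
exact: bigcap_inf.
Qed.

Theorem proposition4p2 (R : realType) (nu mu : probability cantor_borel R)
    (nu_computable : computable_measure nu)
    (mu_computable : computable_measure mu)
    (nu_full : full_support nu) (mu_full : full_support mu)
    (nu_mu : nu `<<_MLR mu) :
  nu `<< mu.
Proof.
apply/null_content_dominatesP => A mA muA0.
apply: contrapT => nuA0.
have ratioE n s :
    ((2 ^+ n)%:E * mu (cylinder s) < nu (cylinder s))%E =
    (2 ^+ n * fine (mu (cylinder s)) < fine (nu (cylinder s))).
  have fin (m : probability cantor_borel R) : m (cylinder s) \is a fin_num.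
    by rewrite fin_num_measure //; exact: measurable_cylinder.
  by rewrite -{1}(fineK (fin mu)) -{1}(fineK (fin nu)) -EFinM lte_fin.
have cU : computable_ce_opens (ratio_open nu mu).
  (* If no string passed at level [n], the open set would be empty and [A] would equal its own null
     part outside of it. *)
  have ratio_ex n : exists s,
      2 ^+ n * fine (mu (cylinder s)) < fine (nu (cylinder s)).
    apply: contrapT => /forallNP nos; apply: nuA0.
    rewrite -(measure_setD_ratio_open nu n mA muA0); congr (nu _).
    apply/seteqP; split=> [w Aw|w []//]; split=> // -[s].
    by rewrite /= ratioE => /nos.
  have := computable_ce_opens_ratio nu_computable mu_computable ratio_ex.
  congr (computable_ce_opens _); apply/funext => n.
  rewrite /ratio_open; congr bigcup; apply/funext => s /=.
  by rewrite ratioE.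
have mD n : measurable (A `\` ratio_open nu mu n).
  by apply: measurableD => //; exact: measurable_ratio_open.
(* The points of [A] to avoid are the nonrandom ones and those missed by some level of the test.
   They form a null set, so a set [A] that is not null has a point left. *)
have null : nu.-negligible (~` MLR nu `|` \bigcup_n (A `\` ratio_open nu mu n)).
  apply: negligibleU; first exact: negligible_setC_MLR.
  apply: negligible_bigcup => n; apply/negligibleP => //.
  exact: measure_setD_ratio_open.
have [w [Aw /not_orP[/contrapT nu_w Uw]]] : exists w,
    A w /\ ~ (~` MLR nu `|` \bigcup_n (A `\` ratio_open nu mu n)) w.
  apply: contrapT => /forallNP nw; apply: nuA0; apply/negligibleP => //.
  by apply: negligibleS null => w Aw; apply: contrapT => ?; exact: (nw w).
have := nu_mu w nu_w _ cU; apply.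
  by move=> n; exact: ratio_open_le.
by move=> n _; apply: contrapT => nUw; apply: Uw; exists n.
Qed.
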